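(* Let $k$ be an algebraically closed field of characteristic zero, let $a(x), b(x) \in k[x]$, and let $D = \partial_x + (a(x)y + b(x))\partial_y$ be the corresponding Shamsuddin derivation of $k[x,y]$, i.e. the $k$-derivation with $D(x)=1$ and $D(y)=a(x)y+b(x)$. If $D$ is a simple derivation, then $\mathrm{Aut}(k[x,y])_D = \{\mathrm{id}\}$; that is, the only $k$-automorphism $\rho$ of $k[x,y]$ with $\rho D = D\rho$ is the identity.
   Context: A $k$-derivation of $k[x,y]$ is a $k$-linear map $d: k[x,y]\to k[x,y]$ with $d(fg)=d(f)g+f\,d(g)$ for all $f,g \in k[x,y]$. A derivation $d$ is called simple if the only ideals $I$ of $k[x,y]$ with $d(I)\subset I$ are $0$ and $k[x,y]$. A Shamsuddin derivation of $k[x,y]$ is a derivation of the form $\partial_x+(a(x)y+b(x))\partial_y$ with $a(x),b(x)\in k[x]$. $\mathrm{Aut}(k[x,y])$ is the group of $k$-algebra automorphisms of $k[x,y]$, and the isotropy group of $D$ is $\mathrm{Aut}(k[x,y])_D = \{\rho\in \mathrm{Aut}(k[x,y]) : \rho\circ D = D\circ\rho\}$. *)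

(* Defs.v *)
From HB Require Import structures.
From mathcomp Require Import all_boot all_order all_algebra.
From mathcomp Require Import mpoly.

Set Implicit Arguments.
Unset Strict Implicit.
Unset Printing Implicit Defensive.

Import GRing.Theory.
Local Open Scope ring_scope.

Definition derivation (k : fieldType) (A : comAlgType k) (d : A -> A) : Prop :=
  linear d /\ forall f g : A, d (f * g) = d f * g + f * d g.

(* Unlike [idealr_closed] of the library, this ranges over arbitrary (not only
   decidable) subsets and admits the unit ideal. *)
Definition is_ideal (A : comNzRingType) (I : A -> Prop) : Prop :=
  [/\ I 0, forall f g : A, I f -> I g -> I (f + g)
    & forall h f : A, I f -> I (h * f)].

Definition simple_derivation (k : fieldType) (A : comAlgType k) (d : A -> A) :
    Prop :=
  derivation d /\
  forall I : A -> Prop, is_ideal I -> (forall f, I f -> I (d f)) ->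
    (forall f, I f <-> f = 0) \/ (forall f, I f).

(* In {mpoly k[2]}, x is 'X_0 and y is 'X_1; [horner_alg 'X_0] is the embedding
   of k[x] into k[x, y]. *)
Definition shamsuddin (k : fieldType) (a b : {poly k}) (f : {mpoly k[2]}) :
    {mpoly k[2]} :=
  f^`M(0) + (horner_alg 'X_0 a * 'X_1 + horner_alg 'X_0 b) * f^`M(1).

(* [{lrmorphism A -> A}] is the type of k-algebra endomorphisms of A, so
   bijectivity of [rho] makes it an automorphism. *)
Definition isotropy (k : fieldType) (A : comAlgType k) (d : A -> A)
    (rho : {lrmorphism A -> A}) : Prop :=
  bijective rho /\ rho \o d =1 d \o rho.

Lemma shamsuddin_derivation (k : fieldType) (a b : {poly k}) :
  derivation (shamsuddin a b).
Proof.
suff dP (c : {mpoly k[2]}) :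
    derivation (fun f : {mpoly k[2]} => f^`M(0) + c * f^`M(1)) by exact: dP.
split=> [e f g|f g].
  by rewrite !linearP /= mulrDr scalerDr -scalerAr addrACA.
rewrite !mderivM; have H (p q r s t u : {mpoly k[2]}) :
  p * u + s * r + c * (q * u + s * t) = (p + c * q) * u + s * (r + c * t).
  by rewrite mulrDl !mulrDr addrACA mulrA [c * (s * t)]mulrCA.
exact: H.
Qed.

Fact subUU (i : 'I_2) : (U_(i) - U_(i) = 0)%MM.
Proof. by apply/mnmP=> j; rewrite mnmBE subnn mnm0E. Qed.

Lemma shamsuddin_x (k : fieldType) (a b : {poly k}) : shamsuddin a b 'X_0 = 1.
Proof.
rewrite /shamsuddin !mderivX !mnm1E /= scale0r mulr0 addr0 scale1r.
by rewrite subUU mpolyX0.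
Qed.

Lemma shamsuddin_y (k : fieldType) (a b : {poly k}) :
  shamsuddin a b 'X_1 = horner_alg 'X_0 a * 'X_1 + horner_alg 'X_0 b.
Proof.
rewrite /shamsuddin !mderivX !mnm1E /= scale0r add0r scale1r.
by rewrite subUU mpolyX0 mulr1.
Qed.

(* Main.v *)
(** Simplicity is used only through principal ideals: if [D u] is a multiple of
    [u], then [u] is zero or a unit. Hence the kernel of [D] is [k], and the
    equation [h' = a h + b] has no polynomial solution (otherwise [y - h] would
    generate a stable ideal); in particular [a] is not constant.
    If [rho] commutes with [D], then [rho x - x] is in the kernel, so
    [rho x = x + c]. Write [rho y] as a polynomial in [y] over [k[x]] and
    compare leading coefficients in [D (rho y) = a(x+c) rho y + b(x+c)]: either
    [rho y] is in [k[x]], and shifting it back by [c] solves [h' = a h + b], or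
    [a(x+c) = n a(x)] where [n] is its degree in [y]. Then [n = 1], so that
    [a] is [c]-periodic and [c = 0]. Finally [D (rho y - y) = a (rho y - y)]
    makes [rho y - y] zero or a nonzero constant, and the latter forces
    [a = 0]. *)
Require Import Defs.
From HB Require Import structures.
From mathcomp Require Import all_boot all_order all_algebra.
From mathcomp Require Import ring.
From mathcomp Require Import mpoly.

Import GRing.Theory.
Local Open Scope ring_scope.

(** * Derivations of a commutative algebra *)

Section Derivations.

Context {k : fieldType} {A : comAlgType k} {d : A -> A} (dP : derivation d).

Lemma derivationD : {morph d : f g / f + g}.
Proof. by case: dP => lin_d _ f g; have := lin_d 1 f g; rewrite !scale1r. Qed.

Lemma derivationB : {morph d : f g / f - g}.
Proof.
move=> f g; case: dP => lin_d _; have := lin_d (-1) g f.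
by rewrite !scaleN1r ![- _ + _]addrC.
Qed.

Lemma derivationM f g : d (f * g) = d f * g + f * d g.
Proof. by case: dP. Qed.

Lemma derivation0 : d 0 = 0.
Proof. by rewrite -[X in d X](subrr 0) derivationB subrr. Qed.

Lemma derivation_alg c : d c%:A = 0.
Proof.
have d1 : d 1 = 0.
  have := derivationM 1 1; rewrite !mulr1 mul1r -[LHS]addr0.
  by move/addrI.
have [lin_d _] := dP; have := lin_d c 1 0.
by rewrite !addr0 d1 derivation0 scaler0 addr0.
Qed.

Lemma derivation_horner_alg t p :
  d (horner_alg t p) = horner_alg t p^`() * d t.
Proof.
elim/poly_ind: p => [|p c IHp].
  by rewrite deriv0 !rmorph0 mul0r derivation0.
rewrite derivD derivC addr0 derivM derivX mulr1 !rmorphD !rmorphM /=.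
rewrite horner_algX horner_algC derivationD derivation_alg addr0 derivationM.
by rewrite IHp mulrDl addrC [RHS]addrC mulrAC.
Qed.

(** The principal ideal of [u] is stable because [d (w * u) = (d w + w * v) * u]; by simplicity it
    is zero or contains 1. *)
Lemma simple_derivation_eigen {u v} :
    simple_derivation d -> d u = v * u ->
  u = 0 \/ exists w, w * u = 1.
Proof.
case=> _ simple_d du; pose I f := exists w, f = w * u.
have I_ideal : is_ideal I.
  split=> [|_ _ [w1 ->] [w2 ->]|h _ [w ->]].
  - by exists 0; rewrite mul0r.
  - by exists (w1 + w2); rewrite mulrDl.
  - by exists (h * w); rewrite mulrA.
have I_stable f : I f -> I (d f).
  by case=> w ->; exists (d w + w * v); rewrite derivationM du mulrA mulrDl.
case: (simple_d I I_ideal I_stable) => [I0|I1].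
  by left; apply/I0; exists 1; rewrite mul1r.
by right; have [w ->] := I1 1; exists w.
Qed.

End Derivations.

Lemma lrmorph_horner_alg {k : fieldType} {A B : algType k}
    (rho : {lrmorphism A -> B}) t p :
  rho (horner_alg t p) = horner_alg (rho t) p.
Proof.
elim/poly_ind: p => [|p c IHp]; first by rewrite !rmorph0.
by rewrite !rmorphD !rmorphM /= !horner_algX !horner_algC rmorph_alg IHp.
Qed.

Lemma horner_alg_comp {k : fieldType} {A : algType k} (t : A) p q :
  horner_alg t (p \Po q) = horner_alg (horner_alg t q) p.
Proof.
elim/poly_ind: p => [|p c IHp]; first by rewrite comp_poly0 !rmorph0.
rewrite comp_polyD comp_polyM comp_polyX comp_polyC !rmorphD !rmorphM /=.
by rewrite !horner_algX !horner_algC IHp.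
Qed.

Lemma mpoly_gen_ind {n} {R : comNzRingType} (P : {mpoly R[n]} -> Prop) :
    (forall c, P c%:MP) -> (forall i, P 'X_i) ->
    (forall p q, P p -> P q -> P (p + q)) ->
    (forall p q, P p -> P q -> P (p * q)) ->
  forall p, P p.
Proof.
move=> PC PX PD PM; elim/mpolyind => [|c m p _ _ Pp].
  by rewrite -mpolyC0; apply: PC.
apply: (PD) => //; rewrite -mul_mpolyC; apply: (PM) => //.
rewrite mpolyXE_id; apply: big_ind => [||i _]; [exact: PC | exact: (PM) |].
elim: (m i) => [|j IHj]; first by rewrite expr0; apply: (PC).
by rewrite exprS; apply: (PM).
Qed.

(** * Univariate polynomials in characteristic zero: linear equations and periods *)

Section LinearODE.

Context {k : fieldType} (char0 : [pchar k] =i pred0).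

Lemma natf_eq0 n : (n%:R == 0 :> k) = (n == 0)%N.
Proof. exact: (pcharf0P k).1. Qed.

Lemma poly_antiderivative (b : {poly k}) : exists h, h^`() = b.
Proof.
(* The entry at [i = 0] is a division by zero, hence 0; the derivative ignores it. *)
exists (\poly_(i < (size b).+1) (b`_i.-1 / i%:R)); apply/polyP=> i.
rewrite coef_deriv coef_poly ltnS; case: ltnP => [_|ge_b] /=.
  by rewrite -[LHS]mulr_natr divfK // natf_eq0.
by rewrite mul0rn nth_default.
Qed.

(** For nonzero [c], induct on the size of [b]: a solution [h] for the right-hand side [b' / c]
    gives the solution [h - b / c] for [b]. *)
Lemma poly_ode_const (c : k) (b : {poly k}) :
  exists h, h^`() = c%:P * h + b.
Proof.
have [->|c_neq0] := eqVneq c 0.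
  by have [h <-] := poly_antiderivative b; exists h; rewrite mul0r add0r.
have cV : c%:P * c^-1%:P = 1 :> {poly k} by rewrite -polyCM divff.
have [n le_bn] := ubnP (size b); elim: n b le_bn => // n IHn b le_bn.
have [->|b_neq0] := eqVneq b 0; first by exists 0; rewrite deriv0 mulr0 addr0.
have [|h Dh] := IHn (c^-1%:P * b^`()).
  rewrite mul_polyC size_scale ?invr_eq0 //.
  exact: leq_trans (lt_size_deriv b_neq0) le_bn.
exists (h - c^-1%:P * b).
rewrite derivB derivM derivC mul0r add0r Dh mulrBr mulrA cV mul1r.
by rewrite addrK subrK.
Qed.

(** Otherwise [p - p(0)] vanishes at the [size p] distinct multiples [c *+ n], one more than its
    degree allows. *)
Lemma periodic_poly_const {p : {poly k}} {c} :
  c != 0 -> p \Po ('X + c%:P) = p -> (size p <= 1)%N.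
Proof.
move=> c_neq0 p_per; have root_p n : p.[c *+ n] = p.[0].
  elim: n => [|n IHn] //; rewrite -IHn -{2}p_per horner_comp !hornerE.
  by rewrite mulrS addrC.
rewrite leqNgt; apply/negP=> gt1_p.
pose q := p - p.[0]%:P; pose rs := [seq c *+ n | n <- iota 0 (size p)].
have size_q : size q = size p.
  rewrite size_polyDl // size_polyN size_polyC.
  exact: leq_ltn_trans (leq_b1 _) gt1_p.
have: (size rs < size q)%N; last by rewrite size_map size_iota size_q ltnn.
apply: max_poly_roots.
- by rewrite -size_poly_gt0 size_q (ltnW gt1_p).
- by apply/allP=> _ /mapP[n _ ->]; rewrite rootE !hornerE root_p subrr.
rewrite map_inj_uniq ?iota_uniq // => m n.
wlog le_mn : m n / (m <= n)%N.
  by move=> IH; case/orP: (leq_total m n) => /IH // + /esym => /[apply].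
move=> /esym/eqP; rewrite -subr_eq0 -mulrnBr // -mulr_natr mulf_eq0.
rewrite (negPf c_neq0) natf_eq0 subn_eq0 => le_nm.
by apply/eqP; rewrite eqn_leq le_mn.
Qed.

(** Differentiation lowers the degree, while multiplication by a nonzero [u] does not. *)
Lemma poly_logderiv_eq0 {u g : {poly k}} : g != 0 -> g^`() = u * g -> u = 0.
Proof.
move=> g_neq0 Dg; apply: contraTeq (lt_size_deriv g_neq0) => u_neq0.
rewrite Dg size_mul // -leqNgt -(prednK (n := size u)) ?size_poly_gt0 //.
exact: leq_addl.
Qed.

End LinearODE.

(** * Passage from k[x,y] to k[x][y] *)

Section Bivariate.

Context {k : fieldType}.

Definition biv_var (i : 'I_2) : {poly {poly k}} :=
  if i == 0 then 'X%:P else 'X.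

(** Makes degree and leading coefficient in y available, with coefficients in k[x]. *)
Definition biv : {mpoly k[2]} -> {poly {poly k}} :=
  mmap (polyC \o polyC) biv_var.

HB.instance Definition _ := GRing.RMorphism.on biv.

Lemma bivC c : biv c%:MP = c%:P%:P.
Proof. exact: mmapC. Qed.

Lemma biv_X : biv 'X_0 = 'X%:P.
Proof. by rewrite /biv mmapX mmap1U. Qed.

Lemma biv_Y : biv 'X_1 = 'X.
Proof. by rewrite /biv mmapX mmap1U. Qed.

Lemma biv_horner_alg p : biv (horner_alg 'X_0 p) = p%:P.
Proof.
elim/poly_ind: p => [|p c IHp]; first by rewrite !rmorph0.
rewrite !rmorphD !rmorphM /= horner_algX horner_algC IHp biv_X.
by rewrite alg_mpolyC bivC.
Qed.

(** Here [map_poly deriv] is the partial derivative in x and the outer derivative is the one in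
    y. *)
Definition biv_shamsuddin (a b : {poly k}) (p : {poly {poly k}}) :=
  map_poly deriv p + (a%:P * 'X + b%:P) * p^`().

Lemma biv_shamsuddinP a b f :
  biv (shamsuddin a b f) = biv_shamsuddin a b (biv f).
Proof.
have dP := shamsuddin_derivation a b.
have mapM p q : map_poly deriv (p * q) =
    map_poly deriv p * q + p * map_poly deriv q :> {poly {poly k}}.
  apply/polyP=> i; rewrite coefD coef_map !coefM raddf_sum /=.
  rewrite -big_split /=; apply: eq_bigr => j _.
  by rewrite derivM !coef_map.
have mapX : map_poly deriv 'X = 0 :> {poly {poly k}}.
  apply/polyP=> i; rewrite coef_map coefX coef0 /=.
  by case: eqP; rewrite ?deriv0 ?derivC.
elim/(@mpoly_gen_ind 2 k): f => [c|i|f g IHf IHg|f g IHf IHg].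
- rewrite -alg_mpolyC (derivation_alg dP) rmorph0 alg_mpolyC bivC.
  by rewrite /biv_shamsuddin map_polyC /= !derivC mulr0 addr0.
- have [->|->] : i = 0 \/ i = 1.
    by case: i => [[|[|//]] ?]; [left|right]; apply: val_inj.
  + rewrite shamsuddin_x rmorph1 biv_X /biv_shamsuddin map_polyC /=.
    by rewrite !derivC derivX mulr0 addr0.
  + rewrite shamsuddin_y rmorphD rmorphM /= !biv_horner_alg biv_Y.
    by rewrite /biv_shamsuddin derivX mulr1 mapX add0r.
- rewrite (derivationD dP) rmorphD [biv (f + g)]rmorphD /= IHf IHg /biv_shamsuddin.
  by rewrite raddfD derivD /=; ring.
- rewrite (derivationM dP) rmorphD [biv (f * g)]rmorphM /=.
  rewrite [biv (_ * g)]rmorphM [biv (f * _)]rmorphM /= IHf IHg /biv_shamsuddin.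
  by rewrite mapM derivM; ring.
Qed.

End Bivariate.

(** * Consequences of simplicity *)

Section Simple.

Context {k : fieldType} (char0 : [pchar k] =i pred0) {a b : {poly k}}.
Hypothesis simple_D : simple_derivation (shamsuddin a b).

Let DP := shamsuddin_derivation a b.

Lemma shamsuddin_ker {f} : shamsuddin a b f = 0 -> exists c : k, f = c%:A.
Proof.
(* With [c] the value at the origin, [f - c] vanishes there and so cannot be a unit. *)
move=> Df0; pose c := f.@[fun=> 0]; exists c.
have Dfc : shamsuddin a b (f - c%:A) = 0 * (f - c%:A).
  by rewrite mul0r (derivationB DP) Df0 (derivation_alg DP) subrr.
have [/eqP|[w /(congr1 (meval (fun=> 0)))]] :=
  simple_derivation_eigen DP simple_D Dfc.
  by rewrite subr_eq0 => /eqP.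
rewrite alg_mpolyC mevalM mevalB mevalC subrr mulr0 meval1 => /esym/eqP.
by rewrite oner_eq0.
Qed.

Lemma shamsuddin_ode_unsolvable h : h^`() <> a * h + b.
Proof.
move=> Dh; set u : {mpoly k[2]} := 'X_1 - horner_alg 'X_0 h.
have Du : shamsuddin a b u = horner_alg 'X_0 a * u.
  rewrite (derivationB DP) shamsuddin_y (derivation_horner_alg DP).
  by rewrite shamsuddin_x Dh rmorphD rmorphM /= /u; ring.
have biv_u : biv u = 'X - h%:P by rewrite rmorphB /= biv_Y biv_horner_alg.
have [/(congr1 biv)|[w /(congr1 biv)]] :=
  simple_derivation_eigen DP simple_D Du.
  by rewrite biv_u rmorph0 => /eqP; rewrite polyXsubC_eq0.
(* Substituting [h] for y kills [u], so [u] is not a unit. *)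
rewrite rmorphM rmorph1 /= biv_u => /(congr1 (horner^~ h)).
by rewrite !hornerE subrr mulr0 => /esym/eqP; rewrite oner_eq0.
Qed.

Lemma shamsuddin_coef_nonconst : (1 < size a)%N.
Proof.
rewrite ltnNge; apply/negP => /size1_polyC a_const.
have [h] := poly_ode_const char0 a`_0 b.
by rewrite -a_const; apply: shamsuddin_ode_unsolvable.
Qed.

Lemma shamsuddin_shift {c g} :
    shamsuddin a b g = horner_alg ('X_0 + c%:A) a * g
                       + horner_alg ('X_0 + c%:A) b ->
  c = 0.
Proof.
have shiftE p : biv (horner_alg ('X_0 + c%:A) p) = (p \Po ('X + c%:P))%:P.
  rewrite -biv_horner_alg horner_alg_comp rmorphD /=.
  by rewrite horner_algX horner_algC.
move=> /(congr1 biv); rewrite biv_shamsuddinP rmorphD rmorphM /= !shiftE.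
move: (biv g) => {g} G DG.
(* Compare coefficients of y^i; b(x+c) contributes only for [i = 0]. *)
have coefG (i : nat) : (G`_i)^`() + (if i is j.+1 then a * (G`_i *+ i) else 0)
      + b * (G`_i.+1 *+ i.+1)
    = (a \Po ('X + c%:P)) * G`_i + (b \Po ('X + c%:P)) *+ (i == 0)%N.
  have /(congr1 (fun p : {poly {poly k}} => p`_i)) := DG.
  rewrite /biv_shamsuddin mulrDl -mulrA !coefD !coefCM coef_map /= coefXM.
  rewrite coefC !coef_deriv addrA.
  by case: i => [|i] /=; rewrite ?mulr0 ?mulr1n ?mulr0n.
have [le1_G|gt1_G] := leqP (size G) 1.
  have := coefG 0%N; rewrite (nth_default 0 le1_G) mul0rn mulr0 !addr0 mulr1n.
  set h := G`_0 => Dh.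
  case: (@shamsuddin_ode_unsolvable (h \Po ('X - c%:P))).
  rewrite deriv_comp derivB derivX derivC subr0 mulr1 Dh.
  rewrite comp_polyD comp_polyM -!comp_polyA comp_polyD comp_polyX comp_polyC.
  by rewrite subrK !comp_polyXr.
have [n sizeG] : exists n, size G = n.+2.
  by case: (size G) gt1_G => [|[|n]]; last exists n.
have lcG : G`_n.+1 != 0.
  rewrite -[n.+1]/(n.+2.-1) -sizeG -lead_coefE lead_coef_eq0.
  by rewrite -size_poly_gt0 sizeG.
(* In the top degree n+1 both [b] terms vanish, so the leading coefficient g satisfies g' = (a(x+c)
   - (n+1) a) g. *)
have := coefG n.+1; rewrite [G`_n.+2]nth_default ?sizeG // mul0rn mulr0 !addr0.
move=> DGn; have: a \Po ('X + c%:P) - a *+ n.+1 = 0.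
  apply: (poly_logderiv_eq0 lcG); rewrite mulrBl -DGn mulrnAl -mulrnAr.
  by rewrite addrK.
move/eqP; rewrite subr_eq0 => /eqP a_shift.
have gt1_a := shamsuddin_coef_nonconst.
have lc_shift : lead_coef (a \Po ('X + c%:P)) = lead_coef a.
  by rewrite lead_coef_comp ?size_XaddC // lead_coefXaddC expr1n mulr1.
(* Translation preserves the leading coefficient of [a], which is nonzero; hence n+1 = 1 in [k]. *)
have n0 : n = 0%N.
  move: lc_shift; rewrite a_shift -scaler_nat lead_coefZ => /eqP.
  rewrite -subr_eq0 -[X in _ - X]mul1r -mulrBl mulf_eq0 lead_coef_eq0.
  rewrite -size_poly_eq0 gtn_eqF ?(ltnW gt1_a) // orbF.
  by rewrite -natr1 addrK natf_eq0 // => /eqP.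
apply: contraTeq gt1_a => c_neq0; rewrite -leqNgt.
by apply: (periodic_poly_const char0 c_neq0); rewrite a_shift n0.
Qed.

End Simple.

Theorem theorem6 (k : closedFieldType) (char0 : [pchar k] =i pred0)
    (a b : {poly k}) :
  simple_derivation (shamsuddin a b) ->
  forall rho : {lrmorphism {mpoly k[2]} -> {mpoly k[2]}},
    isotropy (shamsuddin a b) rho <-> rho =1 id.
Proof.
move=> simple_D rho; have DP := shamsuddin_derivation a b.
split=> [[_ rhoD]|rho_id]; last first.
  by split=> [|f]; [exists id => f; rewrite rho_id | rewrite /= !rho_id].
have [c rho_x] : exists c : k, rho 'X_0 - 'X_0 = c%:A.
  apply: (shamsuddin_ker simple_D); rewrite (derivationB DP) -[_ (rho _)]rhoD.
  by rewrite /= !shamsuddin_x rmorph1 subrr.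
have {}rho_x : rho 'X_0 = 'X_0 + c%:A by rewrite -rho_x addrC subrK.
have Dy : shamsuddin a b (rho 'X_1) =
    horner_alg ('X_0 + c%:A) a * rho 'X_1 + horner_alg ('X_0 + c%:A) b.
  rewrite -[LHS]rhoD /= shamsuddin_y rmorphD rmorphM /=.
  by rewrite !lrmorph_horner_alg rho_x.
have c0 := shamsuddin_shift char0 simple_D Dy.
rewrite c0 scale0r addr0 in rho_x Dy.
have rho_y : rho 'X_1 = 'X_1.
  apply/eqP; rewrite -subr_eq0; apply/eqP; set u := _ - _.
  have Du : shamsuddin a b u = horner_alg 'X_0 a * u.
    by rewrite (derivationB DP) Dy shamsuddin_y /u; ring.
  (* A unit [u] is constant, so [D u = 0] and thus [a * u = 0]; since [a] is nonzero, [u = 0] here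
     too. *)
  have [//|[w /mpoly_intro_unit/andP[/eqP u_const _]]] :=
    simple_derivation_eigen DP simple_D Du.
  have := derivation_alg DP u@_0; rewrite alg_mpolyC -u_const Du => /eqP.
  rewrite mulf_eq0 => /orP[/eqP/(congr1 biv)|/eqP//].
  rewrite biv_horner_alg rmorph0 => /eqP; rewrite polyC_eq0 => /eqP a0.
  by have := shamsuddin_coef_nonconst char0 simple_D; rewrite a0 size_poly0.
elim/(@mpoly_gen_ind 2 k) => [e|i|f g IHf IHg|f g IHf IHg].
- by rewrite -alg_mpolyC rmorph_alg.
- have [->|->] // : i = 0 \/ i = 1.
  by case: i => [[|[|//]] ?]; [left|right]; apply: val_inj.
- by rewrite rmorphD /= IHf IHg.
- by rewrite rmorphM /= IHf IHg.
Qed.
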